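(* Let $(H_n)_{n\in\mathbb{N}}$ be a countable collection of groups. Then the natural map $$\mathrm{Ab}\Big(\prod_{i\in\mathbb{N}}H_i\Big)\longrightarrow\prod_{i\in\mathbb{N}}\mathrm{Ab}(H_i)$$ is surjective, and its kernel is a cotorsion group of Ulm length that does not exceed $\aleph_1$.
   Context: For a group $G$, $\mathrm{Ab}(G)=G/\mathrm{C}(G)$, where $\mathrm{C}(G)$ is the commutator subgroup; $\mathrm{Ab}$ is a functor from groups to abelian groups. The natural map is the one induced by applying $\mathrm{Ab}$ to the projections $\prod_i H_i\to H_j$. An abelian group $A$ is cotorsion if $\mathrm{Ext}(\mathbb{Q},A)=0$, i.e. for every abelian group $B$ containing $A$ as a subgroup with $B/A\cong\mathbb{Q}$, $A$ is a direct summand of $B$. Ulm length: for an abelian group $A$ define subgroups $A^\lambda$ by transfinite recursion on ordinals: $A^0=A$; $A^{\lambda+1}=\bigcap_{n=1}^\infty nA^\lambda$, where $nB=\{nb: b\in B\}$; $A^\delta=\bigcap_{\lambda<\delta}A^\lambda$ for limit ordinals $\delta$. The Ulm length $u(A)$ is the smallest ordinal $\lambda$ with $A^{\lambda+1}=A^\lambda$. The cardinal $\aleph_1$ is regarded as an ordinal (the first uncountable ordinal). *)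

(* Defs.v *)
From HB Require Import structures.
From mathcomp Require Import all_boot all_order all_algebra.
From mathcomp Require Import boolp classical_sets cardinality wochoice.

Set Implicit Arguments.
Unset Strict Implicit.
Unset Printing Implicit Defensive.

Import GRing.Theory.
Local Open Scope classical_set_scope.
Local Open Scope quotient_scope.

Section Derived.
Variable G : groupType.
Local Open Scope group_scope.

Definition subgroup (S : set G) : Prop :=
  S 1 /\ forall x y, S x -> S y -> S (x * y^-1).

Definition derived : set G :=
  smallest subgroup [set g | exists x y : G, g = [~ x, y]].

Lemma derived_comm x y : derived [~ x, y].
Proof. by move=> S [_]; apply; exists x, y. Qed.

Lemma derived_subgroup : subgroup derived.
Proof.
split=> [S [[]]//|x y Dx Dy S SX].
by case: (SX) => -[_ SM] _; apply: SM; [exact: Dx | exact: Dy].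
Qed.

Lemma derivedV x : derived x -> derived x^-1.
Proof. by case: derived_subgroup => D1 DM /(DM _ _ D1); rewrite mul1g. Qed.

Lemma derivedM x y : derived x -> derived y -> derived (x * y).
Proof.
case: derived_subgroup => D1 DM Dx /derivedV Dy.
by have := DM _ _ Dx Dy; rewrite invgK.
Qed.

Lemma derivedJ x y : derived x -> derived (y^-1 * x * y).
Proof.
move=> Dx; suff -> : y^-1 * x * y = x * [~ x, y].
  by apply: derivedM => //; apply: derived_comm.
by rewrite /commg /conjg mulVKg mulgA.
Qed.

Definition Ab_equiv : rel G := fun x y => `[< derived (x^-1 * y) >].

Lemma Ab_equiv_is_equiv : equiv_class_of Ab_equiv.
Proof.
split=> [x|x y|y x z]; rewrite /Ab_equiv.
- by apply/asboolP; rewrite mulVg; case: derived_subgroup.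
- by apply/asbool_equiv_eq; split=> /derivedV; rewrite invgM invgK.
- move=> /asboolP Dxy /asboolP Dyz; apply/asboolP.
  by have := derivedM Dxy Dyz; rewrite mulgA mulgK.
Qed.

Canonical Ab_equivRel := EquivRelPack Ab_equiv_is_equiv.
Canonical Ab_encModRel := defaultEncModRel Ab_equiv.

(* Ab(G) is the type of cosets x C(G), written additively. *)
Definition Ab := {eq_quot Ab_equiv}.
HB.instance Definition _ := EqQuotient.on Ab.
HB.instance Definition _ := Choice.on Ab.

Definition Ab_proj (x : G) : Ab := \pi_Ab x.

Lemma Ab_projP x y : reflect (derived (x^-1 * y)) (Ab_proj x == Ab_proj y).
Proof. by rewrite /Ab_proj piE; apply: asboolP. Qed.

Lemma Ab_projE x y : derived (x^-1 * y) -> Ab_proj x = Ab_proj y.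
Proof. by move/Ab_projP/eqP. Qed.

Lemma Ab_repr (a : Ab) : Ab_proj (repr a) = a.
Proof. exact: reprK. Qed.

Lemma derived_repr x : derived ((repr (Ab_proj x))^-1 * x).
Proof. by apply/Ab_projP; rewrite Ab_repr. Qed.

Definition Ab_zero : Ab := Ab_proj 1.
Definition Ab_add (a b : Ab) : Ab := Ab_proj (repr a * repr b).
Definition Ab_opp (a : Ab) : Ab := Ab_proj (repr a)^-1.

Lemma Ab_addE x y : Ab_add (Ab_proj x) (Ab_proj y) = Ab_proj (x * y).
Proof.
apply: Ab_projE; set x' := repr _; set y' := repr _.
have Dx : derived (x'^-1 * x) := derived_repr x.
have Dy : derived (y'^-1 * y) := derived_repr y.
have := derivedM (derivedJ y' Dx) Dy.
by rewrite invgM !mulgA mulgK.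
Qed.

Lemma Ab_oppE x : Ab_opp (Ab_proj x) = Ab_proj x^-1.
Proof.
apply: Ab_projE; rewrite invgK; set x' := repr _.
have Dx : derived (x'^-1 * x) := derived_repr x.
by have := derivedV (derivedJ x'^-1 Dx); rewrite invgK mulVKg invgM invgK.
Qed.

Lemma Ab_addA : associative Ab_add.
Proof.
by move=> a b c; rewrite -(Ab_repr a) -(Ab_repr b) -(Ab_repr c) !Ab_addE mulgA.
Qed.

Lemma Ab_addC : commutative Ab_add.
Proof.
move=> a b; rewrite -(Ab_repr a) -(Ab_repr b) !Ab_addE; apply: Ab_projE.
by rewrite invgM -mulgA; apply: derived_comm.
Qed.

Lemma Ab_add0 : left_id Ab_zero Ab_add.
Proof. by move=> a; rewrite -(Ab_repr a) Ab_addE mul1g. Qed.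

Lemma Ab_addN : left_inverse Ab_zero Ab_opp Ab_add.
Proof. by move=> a; rewrite -(Ab_repr a) Ab_oppE Ab_addE mulVg. Qed.

HB.instance Definition _ :=
  GRing.isZmodule.Build Ab Ab_addA Ab_addC Ab_add0 Ab_addN.

End Derived.

Section AbMap.
Variables (G H : groupType) (f : UMagmaMorphism.type G H).
Local Open Scope group_scope.

Definition Ab_map (a : Ab G) : Ab H := Ab_proj (f (repr a)).

Lemma derived_morph x : derived x -> derived (f x).
Proof.
move=> Dx; apply: (Dx [set z | derived (f z)]); split=> [|_ [y [z ->]] /=]; last by rewrite gmulfR; apply: derived_comm.
have [D1 DM] := derived_subgroup H.
by split=> [|y z Dy Dz] /=; rewrite ?gmulf1 // gmulfM gmulfV; apply: DM.
Qed.

Lemma Ab_mapE x : Ab_map (Ab_proj x) = Ab_proj (f x).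
Proof.
apply: Ab_projE; rewrite -gmulfV -gmulfM; apply: derived_morph.
exact: derived_repr.
Qed.

Lemma Ab_map_is_nmod_morphism : nmod_morphism Ab_map.
Proof.
split=> [|a b]; first by rewrite [LHS]Ab_mapE gmulf1.
rewrite -(Ab_repr a) -(Ab_repr b) [X in Ab_map X]Ab_addE !Ab_mapE gmulfM.
by rewrite -Ab_addE.
Qed.

HB.instance Definition _ :=
  GRing.isNmodMorphism.Build (Ab G) (Ab H) Ab_map Ab_map_is_nmod_morphism.

End AbMap.

Section GroupProduct.
Variables (I : Type) (H : I -> groupType).
Local Open Scope group_scope.

Definition gprod : Type := forall i, H i.
HB.instance Definition _ := Choice.copy gprod (forall i, H i).

Definition gprod_one : gprod := fun i => 1.
Definition gprod_mul (x y : gprod) : gprod := fun i => x i * y i.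
Definition gprod_inv (x : gprod) : gprod := fun i => (x i)^-1.

Lemma gprod_mulA : associative gprod_mul.
Proof. by move=> x y z; apply: functional_extensionality_dep => i; apply: mulgA. Qed.
Lemma gprod_mul1g : left_id gprod_one gprod_mul.
Proof. by move=> x; apply: functional_extensionality_dep => i; apply: mul1g. Qed.
Lemma gprod_mulg1 : right_id gprod_one gprod_mul.
Proof. by move=> x; apply: functional_extensionality_dep => i; apply: mulg1. Qed.
Lemma gprod_mulVg : left_inverse gprod_one gprod_inv gprod_mul.
Proof. by move=> x; apply: functional_extensionality_dep => i; apply: mulVg. Qed.
Lemma gprod_mulgV : right_inverse gprod_one gprod_inv gprod_mul.
Proof. by move=> x; apply: functional_extensionality_dep => i; apply: mulgV. Qed.

HB.instance Definition _ := isGroup.Build gprod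
  gprod_mulA gprod_mul1g gprod_mulg1 gprod_mulVg gprod_mulgV.

Definition gproj (i : I) (x : gprod) : H i := x i.

Lemma gprojM i : {morph gproj i : x y / x * y}. Proof. by []. Qed.
Lemma gproj1 i : gproj i 1 = 1. Proof. by []. Qed.

HB.instance Definition _ i := isUMagmaMorphism.Build gprod (H i) (gproj i)
  (conj (gproj1 i) (@gprojM i)).

End GroupProduct.

Section ZmodProduct.
Variables (I : Type) (A : I -> zmodType).
Local Open Scope ring_scope.

Definition zprod : Type := forall i, A i.
HB.instance Definition _ := Choice.copy zprod (forall i, A i).

Definition zprod_zero : zprod := fun i => 0.
Definition zprod_add (x y : zprod) : zprod := fun i => x i + y i.
Definition zprod_opp (x : zprod) : zprod := fun i => - x i.

Lemma zprod_addA : associative zprod_add.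
Proof. by move=> x y z; apply: functional_extensionality_dep => i; apply: addrA. Qed.
Lemma zprod_addC : commutative zprod_add.
Proof. by move=> x y; apply: functional_extensionality_dep => i; apply: addrC. Qed.
Lemma zprod_add0 : left_id zprod_zero zprod_add.
Proof. by move=> x; apply: functional_extensionality_dep => i; apply: add0r. Qed.
Lemma zprod_addN : left_inverse zprod_zero zprod_opp zprod_add.
Proof. by move=> x; apply: functional_extensionality_dep => i; apply: addNr. Qed.

HB.instance Definition _ := GRing.isZmodule.Build zprod
  zprod_addA zprod_addC zprod_add0 zprod_addN.

End ZmodProduct.

Section NaturalMap.
Variables (I : Type) (H : I -> groupType).

(* The natural map: its component at i is Ab applied to the projection at i. *)
Definition Ab_prod_map (a : Ab (gprod H)) : zprod (fun i => Ab (H i)) :=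
  fun i => Ab_map (@gproj I H i) a.

Lemma Ab_prod_map_is_nmod_morphism : nmod_morphism Ab_prod_map.
Proof.
by split=> [|a b]; apply: functional_extensionality_dep => i;
  [exact: raddf0 | exact: raddfD].
Qed.

HB.instance Definition _ := GRing.isNmodMorphism.Build
  (Ab (gprod H)) (zprod (fun i => Ab (H i))) Ab_prod_map
  Ab_prod_map_is_nmod_morphism.

End NaturalMap.
Arguments Ab_prod_map {I} H a.

Section KerIm.
Variables (A B : zmodType) (f : {additive A -> B}).
Local Open Scope ring_scope.

Definition zker : {pred A} := fun a => f a == 0.

Lemma zker_zmod_closed : zmod_closed zker.
Proof.
split=> [|x y]; rewrite !unfold_in ?raddf0 //.
by move=> /eqP fx /eqP fy; rewrite raddfB fx fy subrr.
Qed.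
HB.instance Definition _ := GRing.isZmodClosed.Build A zker zker_zmod_closed.

Record kernel := Kernel { kernel_val :> A; _ : kernel_val \in zker }.
HB.instance Definition _ := [isSub for kernel_val].
HB.instance Definition _ := [Choice of kernel by <:].
HB.instance Definition _ := [SubChoice_isSubZmodule of kernel by <:].

Definition zim : {pred B} := fun b => `[< exists a, f a = b >].

Lemma zim_zmod_closed : zmod_closed zim.
Proof.
split=> [|x y]; rewrite !unfold_in.
  by apply/asboolP; exists 0; rewrite raddf0.
move=> /asboolP[a <-] /asboolP[b <-]; apply/asboolP.
by exists (a - b); rewrite raddfB.
Qed.
HB.instance Definition _ := GRing.isZmodClosed.Build B zim zim_zmod_closed.

End KerIm.

Definition zmod_isomorphic (A B : zmodType) : Prop :=
  exists f : {additive A -> B}, bijective f.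

Definition direct_summand (B : zmodType) (S : zmodClosed B) : Prop :=
  exists C : zmodClosed B,
    (forall b : B, exists s c, [/\ s \in S, c \in C & b = (s + c)%R]) /\
    (forall b : B, b \in S -> b \in C -> b = 0%R).

(* The containment of [A] in [B] as a subgroup is an injective homomorphism
   [i : A -> B], so that the subgroup is the image [zim i]. *)
Definition cotorsion (A : zmodType) : Prop :=
  forall (B : zmodType) (i : {additive A -> B}), injective i ->
  zmod_isomorphic (Quotient.quot (zim i)) rat -> direct_summand (zim i).

(* An ordinal is represented by a well-ordered type; isomorphic well-ordered
   types represent the same ordinal, and the elements of [W] stand for the
   ordinals smaller than that of [W]. *)
Record wotype := WoType {
  wosort :> Type;
  wole : rel wosort;
  wole_wo : well_order wole
}.

Section WoTheory.
Variable W : wotype.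
Implicit Types x y z : W.

Definition wolt x y := ~~ wole y x.

Lemma wo_total x y : wole x y || wole y x.
Proof.
have [|z [[+ zmin] _]] := @wole_wo W (mem [pred t | `[< t = x \/ t = y >]]).
  by exists x; apply/asboolP; left.
move=> /asboolP[] <-; apply/orP; [left|right]; apply: zmin; apply/asboolP; auto.
Qed.

Lemma wo_refl x : wole x x.
Proof. by have /orP[] := wo_total x x. Qed.

Lemma wo_anti x y : wole x y -> wole y x -> x = y.
Proof.
move=> xy yx; set P : {pred W} := [pred t | `[< t = x \/ t = y >]].
have [|z [_ zU]] := @wole_wo W P; first by exists x; apply/asboolP; left.
have: minimum_of (@wole W) P x.
  split; first by apply/asboolP; left.
  by move=> t /asboolP[] ->//; apply: wo_refl.
have: minimum_of (@wole W) P y.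
  split; first by apply/asboolP; right.
  by move=> t /asboolP[] ->//; apply: wo_refl.
by move=> /zU <- /zU.
Qed.

Lemma wo_trans x y z : wole x y -> wole y z -> wole x z.
Proof.
move=> xy yz; set P : {pred W} := [pred t | `[< [\/ t = x, t = y | t = z] >]].
have [|m [[+ mmin] _]] := @wole_wo W P; first by exists x; apply/asboolP/Or31.
have [Px [Py Pz]] : x \in P /\ y \in P /\ z \in P.
  by do ?split; apply/asboolP; [exact: Or31|exact: Or32|exact: Or33].
move=> /asboolP[] mE; subst m.
- exact: mmin.
- by rewrite (wo_anti xy (mmin _ Px)).
- by rewrite -(wo_anti yz (mmin _ Py)).
Qed.

Definition wo_least x : Prop := forall y, wole x y.

Definition wo_succ y x : Prop :=
  wolt y x /\ forall z, wolt z x -> wole z y.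

Definition wo_limit x : Prop := ~ wo_least x /\ ~ exists y, wo_succ y x.

End WoTheory.

(* lambda + 1 : a new largest element [None] is added. *)
Section WoSucc.
Variable W : wotype.

Definition wosucc_le (x y : option W) : bool :=
  match x, y with
  | _, None => true
  | None, Some _ => false
  | Some a, Some b => wole a b
  end.

Lemma wosucc_wo : well_order wosucc_le.
Proof.
apply: antisymmetric_well_order.
  move=> [x|] [y|] //= /andP[xy yx]; congr Some; exact: wo_anti.
move=> P [p Pp].
have [[x Px]|noP] := pselect (exists x, Some x \in P).
  have [|z [[Pz zmin] _]] := @wole_wo W (fun x => Some x \in P); first by exists x.
  by exists (Some z); split=> // -[y|] // Py; apply: zmin.
exists p; split=> // -[y|] Py; first by case: noP; exists y.
by case: p Pp.
Qed.

Definition wosucc : wotype := WoType wosucc_wo.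

End WoSucc.

Definition initial_embedding (V W : wotype) (f : V -> W) : Prop :=
  {mono f : x y / wole x y} /\
  forall x w, wole w (f x) -> exists x', f x' = w.

Definition wotype_le (V W : wotype) : Prop :=
  exists f : V -> W, initial_embedding f.

(* This determines W up to isomorphism: it is aleph_1 seen as an ordinal. *)
Definition first_uncountable (W : wotype) : Prop :=
  ~ countable [set: W] /\ forall x : W, countable [set y | wolt y x].

Section WoSegment.
Variables (W : wotype) (x : W).

Definition woseg_le : rel {y : W | wolt y x} :=
  fun a b => wole (sval a) (sval b).

Lemma woseg_wo : well_order woseg_le.
Proof.
apply: antisymmetric_well_order.
  by move=> [a a_x] [b b_x] /andP[] /= ab ba; apply/eq_exist/wo_anti.
move=> P [p Pp].
pose Q : {pred W} := fun y => `[< exists2 q, q \in P & sval q = y >].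
have [|z [[/asboolP[q Pq <-] zmin] _]] := @wole_wo W Q.
  by exists (sval p); apply/asboolP; exists p.
by exists q; split=> // r Pr; apply: zmin; apply/asboolP; exists r.
Qed.

Definition woseg : wotype := WoType woseg_wo.

End WoSegment.

Lemma first_uncountable_exists : exists W, first_uncountable W.
Proof.
have [R Rwo] := well_ordering_principle (nat -> bool).
pose W0 := WoType Rwo.
have W0unc : ~ countable [set: W0].
  move/countable_injP => -[f finj].
  pose g : nat -> bool := fun n => ~~ `[< exists2 h : W0, f h = n & h n >].
  have gE : g (f g) = ~~ g (f g).
    rewrite {1}/g; congr negb; apply/asboolP/idP => [[h fh]|]; last by exists g.
    by rewrite (finj h g) ?in_setT.
  by case: (g (f g)) gE.
have [cseg|] := pselect (forall x : W0, countable [set y | wolt y x]).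
  by exists W0.
move=> /existsNP[x0 x0unc].
pose P : {pred W0} := fun x => `[< ~ countable [set y | wolt y x] >].
have [|x [[/asboolP xunc xmin] _]] := @wole_wo W0 P.
  by exists x0; apply/asboolP.
exists (woseg x); split.
  apply: contra_not xunc => /countable_injP[f finj]; apply/countable_injP.
  exists (fun y => if pselect (wolt y x) is left yx then f (exist _ y yx) else 0).
  move=> y z; rewrite !inE /= => yx zx.
  case: pselect => // yx'; case: pselect => // zx' /finj.
  by rewrite !in_setT => /(_ isT isT) [].
move=> [y yx]; have : countable [set z | wolt z y].
  apply: contrapT => yunc; move/negP: yx; apply.
  by apply: xmin; apply/asboolP.
move=> /countable_injP[f finj]; apply/countable_injP.
exists (fun a => f (sval a)) => a b; rewrite !inE => ay bx fab.
have := finj (sval a) (sval b); rewrite !inE => /(_ ay bx fab).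
by case: a b {ay bx fab} => a ax [b bx] /= ab; apply: eq_exist.
Qed.

Definition aleph1 : wotype := projT1 (cid first_uncountable_exists).

Lemma aleph1P : first_uncountable aleph1.
Proof. exact: projT2 (cid _). Qed.

Section Ulm.
Variable A : zmodType.
Local Open Scope ring_scope.

Definition divisible_part (B : set A) : set A :=
  \bigcap_(n in [set n : nat | (0 < n)%N]) [set b *+ n | b in B].

(* [ulm_below x] is A^mu, where mu is the ordinal of the elements below [x]. *)
Inductive ulm_below (W : wotype) : W -> set A :=
| UlmZero x a : wo_least x -> ulm_below x a
| UlmSucc y x a : wo_succ y x -> divisible_part (ulm_below y) a ->
    ulm_below x a
| UlmLimit x a : wo_limit x -> (forall y, wolt y x -> ulm_below y a) ->
    ulm_below x a.

Lemma ulm_below_least (W : wotype) (x : W) : wo_least x -> ulm_below x = setT.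
Proof. by move=> x0; apply/seteqP; split=> // a _; apply: UlmZero. Qed.

Lemma ulm_below_succ (W : wotype) (y x : W) :
  wo_succ y x -> ulm_below x = divisible_part (ulm_below y).
Proof.
move=> yx; have [yltx ymax] := yx.
apply/seteqP; split=> a; last exact: UlmSucc yx.
move=> xa; case: xa yx yltx ymax => {x a} [x a x0|z x a zx za|x a xlim _].
- by rewrite /wolt x0.
- case: (zx) => zltx zmax _ yltx ymax.
  by have <- : z = y by apply: wo_anti; [apply: ymax | apply: zmax].
- by move=> yx _ _; case: xlim.2; exists y.
Qed.

Lemma ulm_below_limit (W : wotype) (x : W) :
  wo_limit x -> ulm_below x = \bigcap_(y in [set y | wolt y x]) ulm_below y.
Proof.
move=> xlim; apply/seteqP; split=> a; last exact: UlmLimit.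
move=> xa; case: xa xlim => {x a} [x a x0|z x a zx za|x a _ xa _].
- by case.
- by case=> _ []; exists z.
- exact: xa.
Qed.

(* A^lambda, computed at the largest element of lambda + 1. *)
Definition ulm (lambda : wotype) : set A := @ulm_below (wosucc lambda) None.

Lemma ulm_below_embedding (V W : wotype) (f : V -> W) (x : V) :
  initial_embedding f -> ulm_below x = ulm_below (f x).
Proof.
move=> [fmono finit].
have flt y z : wolt (f y) (f z) = wolt y z by rewrite /wolt fmono.
have fsurj z w : wolt w (f z) -> exists y, f y = w.
  by move=> wz; apply: (finit z); have := wo_total w (f z); rewrite (negPf wz) orbF.
have fsucc y z : wo_succ y z -> wo_succ (f y) (f z).
  move=> [yz ymax]; split=> [|w wz]; first by rewrite flt.
  by have [v vE] := fsurj _ _ wz; move: wz; rewrite -vE flt fmono; apply: ymax.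
have fleast y : wo_least y -> wo_least (f y).
  move=> y0 w; have [//|] := boolP (wole (f y) w) => wy.
  by have [v vE] := fsurj _ _ wy; move: wy; rewrite -vE fmono y0.
have flim y : wo_limit y -> wo_limit (f y).
  move=> [y0 ysucc]; split=> [fy0|[w [wy wmax]]].
    by apply: y0 => z; rewrite -fmono.
  apply: ysucc; have [v vE] := fsurj _ _ wy; exists v; split.
    by rewrite -flt vE.
  by move=> z zy; rewrite -fmono vE; apply: wmax; rewrite flt.
apply: contrapT => xbad.
pose P : {pred V} := fun z => `[< ulm_below z <> ulm_below (f z) >].
have [|z [[/asboolP zbad zmin] _]] := @wole_wo V P.
  by exists x; apply/asboolP.
have zgood y : wolt y z -> ulm_below y = ulm_below (f y).
  by move=> yz; apply: contrapT => ybad; move/negP: yz; apply; apply/zmin/asboolP.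
apply: zbad.
have [z0|z0] := pselect (wo_least z).
  by rewrite !ulm_below_least //; apply: fleast.
have [[y yz]|zs] := pselect (exists y, wo_succ y z).
  by rewrite (ulm_below_succ yz) (ulm_below_succ (fsucc _ _ yz)) zgood ?yz.1.
rewrite !ulm_below_limit; [|exact: flim|by []].
apply/seteqP; split=> a za w /= wz.
  have [v vE] := fsurj _ _ wz; have vz : wolt v z by rewrite -flt vE.
  by rewrite -vE -zgood //; apply: za.
by rewrite zgood //; apply: za; rewrite /= flt.
Qed.

Lemma ulm_wosucc (lambda : wotype) :
  ulm (wosucc lambda) = divisible_part (ulm lambda).
Proof.
pose f : wosucc lambda -> wosucc (wosucc lambda) := Some.
have finit : initial_embedding f.
  by split=> [//|x [w|]] // _; exists w.
rewrite /ulm (ulm_below_embedding (None : wosucc lambda) finit); apply: ulm_below_succ.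
by split=> // -[z|] // _; case: z.
Qed.

(* lambda is the Ulm length u(A); it is unique up to isomorphism. *)
Definition ulm_length (lambda : wotype) : Prop :=
  ulm (wosucc lambda) = ulm lambda /\
  forall mu : wotype, ulm (wosucc mu) = ulm mu -> wotype_le lambda mu.

End Ulm.

(* Main.v *)
(* An element of the product of the groups H i lies in its derived subgroup iff
   all its coordinates are derived and their commutator lengths are bounded for
   almost all i. So the kernel K is a group of sequences of derived elements
   modulo sequences of almost bounded commutator length.

   Cotorsion: finitely many coordinates do not matter, so every system
   x n = a n + (n+1) x (n+1) over K can be solved by a finite descending
   recursion in each coordinate; solvability of these systems splits every
   extension of K by Q.

   Ulm length: the defects in a relation b n = (n+1) b (n+1) are measured by a
   single natural number, their maximal commutator length, so chains starting
   at a given a are governed by a countably branching tree of bound sequences.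
   If a lies in K^x for all countable x, countable suprema yield an infinite
   branch; the finite chains along it can be glued coordinatewise to an infinite
   chain, so a lies in a divisible subgroup. *)
From HB Require Import structures.
Require Import Defs.
From mathcomp Require Import all_boot all_order all_algebra.
From mathcomp Require Import boolp classical_sets cardinality.
From mathcomp Require Import zify ring.

Set Implicit Arguments.
Unset Strict Implicit.
Unset Printing Implicit Defensive.

Import GRing.Theory Num.Theory.
Local Open Scope classical_set_scope.

(** * Commutator length and the derived subgroup of a product *)

Section CommutatorProducts.
Variable G : groupType.
Local Open Scope group_scope.

(** Commutator length at most [k]: trivial commutators pad shorter products. *)
Fixpoint comm_prod (k : nat) (g : G) : Prop :=
  if k is k'.+1 then exists x y h, comm_prod k' h /\ g = [~ x, y] * h
  else g = 1.

Lemma comm_prodM j k g h :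
  comm_prod j g -> comm_prod k h -> comm_prod (j + k)%N (g * h).
Proof.
elim: j g => [|j IH] g /=; first by move=> ->; rewrite mul1g.
move=> [x [y [g' [Cg' ->]]]] Ch; exists x, y, (g' * h).
by rewrite mulgA; split=> //; apply: IH.
Qed.

Lemma comm_prod1 k : comm_prod k 1.
Proof. by elim: k => //= k IH; exists 1, 1, 1; rewrite comm1g mul1g. Qed.

Lemma comm_prod_leq j k g : (j <= k)%N -> comm_prod j g -> comm_prod k g.
Proof.
by move=> /subnK <- Cg; rewrite -[g]mul1g; apply: comm_prodM (comm_prod1 _) Cg.
Qed.

Lemma comm_prodV k g : comm_prod k g -> comm_prod k g^-1.
Proof.
elim: k g => [|k IH] g /=; first by move=> ->; rewrite invg1.
move=> [x [y [h [/IH Ch ->]]]]; rewrite invgM invgR.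
suff: comm_prod (k + 1) (h^-1 * [~ y, x]) by rewrite addn1.
by apply: comm_prodM => //=; exists y, x, 1; rewrite mulg1.
Qed.

Lemma derived_comm_prod (g : G) : derived g <-> exists k, comm_prod k g.
Proof.
split=> [Dg|[k]].
  apply: (Dg [set g | exists k, comm_prod k g]).
  split=> [|_ [x [y ->]]]; last by exists 1%N, x, y, 1; rewrite mulg1.
  split=> [|x y [j Cx] [k /comm_prodV Cy]]; first by exists 0%N.
  by exists (j + k)%N; apply: comm_prodM.
elim: k g => [|k IH] g /=; first by move=> ->; case: (derived_subgroup G).
move=> [x [y [h [/IH Dh ->]]]].
by apply: derivedM => //; apply: derived_comm.
Qed.

Lemma derivedX (g : G) n : derived g -> derived (g ^+ n).
Proof.
move=> Dg; elim: n => [|n IH]; first by case: (derived_subgroup G).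
by rewrite expgS; apply: derivedM.
Qed.

End CommutatorProducts.

Lemma gprodX (I : Type) (H : I -> groupType) (x : gprod H) n i :
  ((x ^+ n) i = x i ^+ n)%g.
Proof. exact: (gmulfXn (@gproj I H i)). Qed.

Section DerivedProduct.
Local Open Scope group_scope.

(** With the same [k] in all coordinates, the factors can be chosen coordinatewise. *)
Lemma comm_prod_gprod (I : Type) (H : I -> groupType) k (x : gprod H) :
  comm_prod k x <-> forall i, comm_prod k (x i).
Proof.
elim: k x => [|k IH] x /=.
  split=> [-> //|x1]; exact: functional_extensionality_dep.
split=> [[y [z [h [/IH Ch ->]]]] i|Cx].
  by exists (y i), (z i), (h i).
pose P i (t : H i * H i * H i) :=
  comm_prod k t.2 /\ x i = [~ t.1.1, t.1.2] * t.2.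
have Pex i : exists t, P i t.
  by have [y [z [h Pt]]] := Cx i; exists (y, z, h).
pose t i := sval (cid (Pex i)).
have Pt i : P i (t i) by rewrite /t; case: cid.
exists (fun i => (t i).1.1), (fun i => (t i).1.2), (fun i => (t i).2).
split; first by apply/IH => i; case: (Pt i).
by apply: functional_extensionality_dep => i; case: (Pt i).
Qed.

Lemma derived_gprodP (H : nat -> groupType) (x : gprod H) :
  derived x <-> (forall i, derived (x i)) /\
    exists k N, forall i, (N <= i)%N -> comm_prod k (x i).
Proof.
split=> [Dx|[Dx [k [N Cx]]]].
  split=> [i|]; first exact: (derived_morph (@gproj _ H i) Dx).
  have /derived_comm_prod[k /comm_prod_gprod Cx] := Dx.
  by exists k, 0%N.
have /choice[l Cl] : forall i, exists l, comm_prod l (x i).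
  by move=> i; apply/derived_comm_prod.
(* Each of the finitely many coordinates below [N] has some finite length; their maximum, added to
   [k], bounds all coordinates. *)
apply/derived_comm_prod; exists (k + \max_(i < N) l i)%N.
apply/comm_prod_gprod => i; have [Ni|iN] := leqP N i.
  by apply: comm_prod_leq (Cx i Ni); apply: leq_addr.
apply: comm_prod_leq (Cl i); apply: leq_trans (leq_addl _ _).
exact: (leq_bigmax (Ordinal iN)).
Qed.

End DerivedProduct.

(** * Abelianizations and the kernel of the natural map *)

Section Abelianization.
Variable G : groupType.
Local Open Scope ring_scope.

Lemma Ab_proj_eq (x y : G) : Ab_proj x = Ab_proj y <-> derived (x^-1 * y)%g.
Proof. by split=> [/eqP/Ab_projP|]; last exact: Ab_projE. Qed.

Lemma Ab_proj0 (x : G) : Ab_proj x = 0 <-> derived x.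
Proof.
split=> [/esym/Ab_proj_eq|Dx]; first by rewrite invg1 mul1g.
by apply/esym/Ab_proj_eq; rewrite invg1 mul1g.
Qed.

Lemma Ab_projM (x y : G) : Ab_proj (x * y)%g = Ab_proj x + Ab_proj y.
Proof. by rewrite -Ab_addE. Qed.

Lemma Ab_projX (x : G) n : Ab_proj (x ^+ n)%g = Ab_proj x *+ n.
Proof.
elim: n => [|n IH]; first by rewrite mulr0n.
by rewrite expgS Ab_projM IH mulrS.
Qed.

End Abelianization.

Section NaturalMapKernel.
Variable H : nat -> groupType.
Local Open Scope ring_scope.
Local Notation K := (kernel (Ab_prod_map H)).

Lemma Ab_prod_map_surj (b : zprod (fun i => Ab (H i))) :
  exists a, Ab_prod_map H a = b.
Proof.
exists (Ab_proj ((fun i => repr (b i)) : gprod H)).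
apply: functional_extensionality_dep => i.
by rewrite [LHS]Ab_mapE Ab_repr.
Qed.

Lemma zker_Ab_prod_map (x : gprod H) :
  (Ab_proj x \in zker (Ab_prod_map H)) <-> forall i, derived (x i).
Proof.
rewrite unfold_in; split=> [/eqP x0 i|Dx].
  apply/Ab_proj0; rewrite -[Ab_proj _](Ab_mapE (@gproj _ H i)).
  exact: (congr1 (@^~ i) x0).
apply/eqP; apply: functional_extensionality_dep => i.
by rewrite [LHS]Ab_mapE; apply/Ab_proj0.
Qed.

Definition coset_rep (a : K) : gprod H := repr (val a).

Lemma derived_coset_rep (a : K) i : derived (coset_rep a i).
Proof. by move: i; apply/zker_Ab_prod_map; rewrite Ab_repr; apply: valP. Qed.

Definition kernel_class (x : gprod H) (Dx : forall i, derived (x i)) : K :=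
  Kernel (proj2 (zker_Ab_prod_map x) Dx).

(** Turns equations in the kernel into derived-subgroup conditions on arbitrary representatives. *)
Lemma kernel_add_mulrn_eq (a b c : K) (x y z : gprod H) n :
    val a = Ab_proj x -> val b = Ab_proj y -> val c = Ab_proj z ->
  a = b + c *+ n <-> derived (x^-1 * (y * z ^+ n))%g.
Proof.
move=> ax by_ cz.
have valE : val (b + c *+ n) = Ab_proj (y * z ^+ n)%g.
  by rewrite raddfD raddfMn Ab_projM Ab_projX -by_ -cz.
rewrite -Ab_proj_eq -ax -valE; split=> [-> //|]; exact: val_inj.
Qed.

Lemma kernel_mulrn_eq (a c : K) (x z : gprod H) n :
    val a = Ab_proj x -> val c = Ab_proj z ->
  a = c *+ n <-> derived (x^-1 * z ^+ n)%g.
Proof.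
move=> ax cz; rewrite -[c *+ n]add0r -[(z ^+ n)%g]mul1g.
exact: kernel_add_mulrn_eq.
Qed.

(* Coordinate i of the solution is found by descending recursion from its
   n-th term with n = i: the finitely many coordinates i <= n of the n-th
   equation, which may fail, are absorbed by the derived subgroup. *)
Lemma kernel_factorial_system (a : nat -> K) :
  exists x : nat -> K, forall n, x n = a n + x n.+1 *+ n.+1.
Proof.
(* For [d <= i], [y i d] is coordinate [i] of the term of index [i - d]. *)
pose fix y i d : H i :=
  if d is d'.+1 then (coset_rep (a (i - d)%N) i * y i d' ^+ (i - d).+1)%g
  else 1%g.
have Dy i d : derived (y i d).
  elim: d => [|d IH] /=; first by case: (derived_subgroup (H i)).
  by apply: derivedM; [apply: derived_coset_rep | apply: derivedX].
(* Truncated subtraction makes coordinate [i] trivial for [n >= i]. *)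
pose z n : gprod H := fun i => y i (i - n)%N.
exists (fun n => kernel_class (fun i => Dy i (i - n)%N : derived (z n i))) => n.
have aE : val (a n) = Ab_proj (coset_rep (a n)) by rewrite Ab_repr.
apply: (iffRL (@kernel_add_mulrn_eq _ _ _ (z n) _ (z n.+1) _ _ aE _)) => //.
apply/derived_gprodP; split=> [i|].
  apply: derivedM; first by apply: derivedV; apply: Dy.
  apply: derivedM; first exact: derived_coset_rep.
  by rewrite gprodX; apply: derivedX; apply: Dy.
(* Equation [n] holds exactly in every coordinate beyond [n]. *)
exists 0%N, n.+1 => i ni.
have zE : z n i = (coset_rep (a n) i * z n.+1 i ^+ n.+1)%g.
  rewrite /z -[(i - n)%N]prednK ?subn_gt0 // -subnS /=.
  by have -> : (i - (i - n.+1).+1 = n)%N by lia.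
have -> : ((z n)^-1 * (coset_rep (a n) * z n.+1 ^+ n.+1))%g i =
    ((z n i)^-1 * (coset_rep (a n) i * z n.+1 i ^+ n.+1))%g by rewrite -gprodX.
by rewrite -zE mulVg.
Qed.

End NaturalMapKernel.

(** * Divisible chains and cotorsion groups *)

Section FactorialChain.
Local Open Scope ring_scope.
Variable B : zmodType.
Implicit Type c : nat -> B.

(** Such a sequence is the image of the [1/n!] under a homomorphism from the rationals. *)
Definition factorial_chain c : Prop := forall n, c n = c n.+1 *+ n.+1.

Lemma factorial_chain_leq c m n :
  factorial_chain c -> (m <= n)%N -> exists p, c m = c n *+ p.
Proof.
move=> cS /subnK <-; elim: (n - m)%N => [|d [p cm]]; first by exists 1%N.
by exists ((d + m).+1 * p)%N; rewrite cm cS mulrnA.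
Qed.

Definition chain_span c : {pred B} := fun b => `[< exists n z, b = c n *~ z >].

Lemma chain_span_zmod_closed c : factorial_chain c -> zmod_closed (chain_span c).
Proof.
move=> cS; split=> [|x y]; rewrite !unfold_in.
  by apply/asboolP; exists 0%N, 0.
move=> /asboolP[m [u ->]] /asboolP[n [v ->]]; apply/asboolP.
have [p ->] := factorial_chain_leq cS (leq_maxl m n).
have [q ->] := factorial_chain_leq cS (leq_maxr m n).
by exists (maxn m n), (p%:Z * u - q%:Z * v); rewrite mulrzBr !pmulrn -!mulrzA.
Qed.

Lemma chain_span_divisible c : factorial_chain c ->
  [set b | b \in chain_span c] `<=` divisible_part [set b | b \in chain_span c].
Proof.
move=> cS _ /asboolP[m [z ->]] n /= n0.
(* The chain step into index [n * m.+1] multiplies by [n * m.+1], a multiple of [n]. *)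
have mn : (m <= (n * m.+1).-1)%N by nia.
have [p ->] := factorial_chain_leq cS mn.
rewrite cS prednK ?muln_gt0 ?n0 //.
exists (c (n * m.+1)%N *~ (m.+1%:Z * p%:Z * z)); last first.
  by rewrite !pmulrn -!mulrzA; congr (_ *~ _); rewrite PoszM; ring.
by apply/asboolP; exists (n * m.+1)%N, (m.+1%:Z * p%:Z * z).
Qed.

End FactorialChain.

Section Cotorsion.
Local Open Scope ring_scope.
Local Open Scope quotient_scope.

(* Lift the generators 1/n! of rat to elements b n of B; then
   b n - (n+1) b (n+1) lies in A, and subtracting a solution of the resulting
   system from b yields lifts spanning a complement of A. *)
Lemma factorial_system_cotorsion (A : zmodType) :
  (forall a : nat -> A,
     exists x : nat -> A, forall n, x n = a n + x n.+1 *+ n.+1) ->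
  cotorsion A.
Proof.
move=> A_solvable B i iinj [f [g fK gK]].
pose pr (b : B) : rat := f (\pi_(Quotient.quot (zim i)) b).
have prB : {morph pr : x y / x - y} by move=> x y; rewrite /pr !raddfB.
have prMn b n : pr (b *+ n) = pr b *+ n by rewrite /pr !raddfMn.
have prMz b z : pr (b *~ z) = pr b *~ z by rewrite /pr !raddfMz.
have pr0 b : (b \in zim i) = (pr b == 0).
  rewrite -[b in LHS]subr0 Quotient.idealrBE /pr.
  by rewrite -(inj_eq (can_inj fK)) !raddf0.
pose b n : B := repr (g (n`!%:R^-1 : rat)).
have prb n : pr (b n) = n`!%:R^-1 by rewrite /pr reprK gK.
have invfactS n : (n`!%:R^-1 : rat) = n.+1`!%:R^-1 *+ n.+1.
  by rewrite -[RHS]mulr_natr factS natrM invfM mulrAC mulVf ?mul1r // pnatr_eq0.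
have aex n : exists a, i a = b n - b n.+1 *+ n.+1.
  apply/asboolP; change (b n - b n.+1 *+ n.+1 \in zim i).
  by rewrite pr0 prB prMn !prb invfactS subrr.
have [a aE] := choice aex.
have [x xE] := A_solvable a.
pose c n := b n - i (x n).
have cS : factorial_chain c.
  move=> n; rewrite /c xE raddfD raddfMn aE mulrnBl opprD opprB addrA.
  by rewrite addrCA subrr addr0.
have prc n : pr (c n) = n`!%:R^-1.
  rewrite prB prb (_ : pr (i _) = 0) ?subr0 //.
  by apply/eqP; rewrite -pr0; apply/asboolP; exists (x n).
pose C : zmodClosed B := HB.pack (chain_span c)
  (GRing.isZmodClosed.Build B (chain_span c) (chain_span_zmod_closed cS)).
exists C; split=> [y|y yA /asboolP[n [z yE]]].
  (* With [n] the denominator of [pr y], the integer [z] equals [pr y * n!], so [c n *~ z] and [y]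
     have the same image. *)
  pose n := `|denq (pr y)|%N; pose z := numq (pr y) * (n.-1)`!%:Z.
  exists (y - c n *~ z), (c n *~ z); split; last by rewrite subrK.
  - have n0 : (0 < n)%N by rewrite absz_gt0 denq_neq0.
    have dE : denq (pr y) = n%:Z by rewrite absz_denq.
    have zE : z%:~R = pr y * n`!%:R.
      by rewrite intrM numqE dE -mulrA -natrM -{1}(prednK n0) -factS prednK.
    rewrite pr0 prB prMz prc -mulrzr zE mulrC mulfK ?subrr //.
    by rewrite pnatr_eq0 -lt0n fact_gt0.
  - by apply/asboolP; exists n, z.
move: yA; rewrite yE pr0 prMz prc -mulrzr mulf_eq0 invr_eq0 pnatr_eq0 intr_eq0.
by rewrite eqn0Ngt fact_gt0 /= => /eqP ->.
Qed.

End Cotorsion.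

(** * Comparison of well orders *)

Section WellOrders.
Implicit Types V W : wotype.

Lemma wo_ind W (P : W -> Prop) :
  (forall x, (forall y, wolt y x -> P y) -> P x) -> forall x, P x.
Proof.
move=> IH x; apply: contrapT => Px.
have [|m [[/asboolP mP mmin] _]] := @wole_wo W (fun x => `[< ~ P x >]).
  by exists x; apply/asboolP.
apply: mP; apply: IH => y ym; apply: contrapT => Py.
by move/negP: ym; apply; apply/mmin/asboolP.
Qed.

Lemma wo_min W (P : W -> Prop) (x0 : W) :
  P x0 -> exists x, P x /\ forall y, wolt y x -> ~ P y.
Proof.
move=> Px0; apply: contrapT => noMin.
by elim/wo_ind: x0 Px0 => x IH Px; apply: noMin; exists x.
Qed.

Lemma wolt_irr W (x : W) : ~ wolt x x.
Proof. by rewrite /wolt wo_refl. Qed.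

Lemma wolt_le W (x y : W) : wolt x y -> wole x y.
Proof. by have := wo_total x y; rewrite /wolt => /orP[|->]. Qed.

Lemma wole_lt_trans W (x y z : W) : wole x y -> wolt y z -> wolt x z.
Proof. by move=> xy; apply: contraNN => zx; apply: wo_trans xy. Qed.

Lemma wo_trichotomy W (x y : W) : [\/ wolt x y, x = y | wolt y x].
Proof.
case: (boolP (wole x y)) => xy; last by apply: Or33.
case: (boolP (wole y x)) => yx; last by apply: Or31.
by apply/Or32/wo_anti.
Qed.

(* [same_rank x y] : the initial segments below x and y are isomorphic. *)
Inductive same_rank V W : V -> W -> Prop :=
  SameRank x y :
    (forall x', wolt x' x -> exists2 y', wolt y' y & same_rank x' y') ->
    (forall y', wolt y' y -> exists2 x', wolt x' x & same_rank x' y') ->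
    same_rank x y.

Lemma same_rankP V W (x : V) (y : W) : same_rank x y ->
  (forall x', wolt x' x -> exists2 y', wolt y' y & same_rank x' y') /\
  (forall y', wolt y' y -> exists2 x', wolt x' x & same_rank x' y').
Proof. by case. Qed.

(** If [y] and [z] differed, the smaller one would share a partner below [x] with an element
    strictly below itself, against induction. *)
Lemma same_rank_fun V W (x : V) (y z : W) :
  same_rank x y -> same_rank x z -> y = z.
Proof.
elim/wo_ind: x y z => x IH y z /same_rankP[xy yx] /same_rankP[xz zx].
case: (wo_trichotomy y z) => // [yz|zy].
  have [x' x'x x'y] := zx _ yz; have [y' y'y x'y'] := xy _ x'x.
  by rewrite (IH _ x'x _ _ x'y x'y') in y'y *; case: (wolt_irr y'y).
have [x' x'x x'z] := yx _ zy; have [z' z'z x'z'] := xz _ x'x.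
by rewrite (IH _ x'x _ _ x'z x'z') in z'z *; case: (wolt_irr z'z).
Qed.

Lemma same_rank_sym V W (x : V) (y : W) : same_rank x y -> same_rank y x.
Proof.
elim/wo_ind: x y => x IH y /same_rankP[xy yx].
constructor=> [y' /yx[x' x'x x'y']|x' x'x]; first by exists x' => //; apply: IH.
by have [y' y'y x'y'] := xy _ x'x; exists y' => //; apply: IH.
Qed.

Lemma same_rank_below V W (x : V) (y y' : W) :
  same_rank x y -> wole y' y -> exists x' : V, same_rank x' y'.
Proof.
move=> xy; case: (wo_trichotomy y' y) => [y'y _|->|/negP //]; last by exists x.
by have [_ yx] := same_rankP xy; have [x' _ ?] := yx _ y'y; exists x'.
Qed.

Lemma same_rank_le V W (x x' : V) (y y' : W) :
  same_rank x y -> same_rank x' y' -> wole x x' = wole y y'.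
Proof.
have lt (A B : wotype) (a a' : A) (b b' : B) :
    same_rank a b -> same_rank a' b' -> wolt a' a -> wolt b' b.
  move=> /same_rankP[ab _] a'b' /ab[c cb a'c].
  by rewrite (same_rank_fun a'b' a'c).
move=> xy x'y'; apply: negb_inj; apply/idP/idP; first exact: lt xy x'y'.
by apply: lt; apply: same_rank_sym.
Qed.

Lemma same_rank_total V W :
  (forall x : V, exists y : W, same_rank x y) ->
  exists2 f : V -> W, initial_embedding f & forall x, same_rank x (f x).
Proof.
move=> /choice[f fP]; exists f => //; split=> [x x'|x w wx].
  by rewrite (same_rank_le (fP x) (fP x')).
have [x' x'w] := same_rank_below (fP x) wx.
by exists x'; apply: same_rank_fun (fP x') x'w.
Qed.

Lemma wo_comparable V W :
  wotype_le V W \/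
  exists (x : V) (f : W -> V), initial_embedding f /\
    forall v, (exists w, f w = v) <-> wolt v x.
Proof.
have [all_V|/existsNP[x0 nx0]] :=
  pselect (forall x : V, exists y : W, same_rank x y).
  by left; have [f fi _] := same_rank_total all_V; exists f.
right; have [x [nx xmin]] :=
  @wo_min V (fun x => ~ exists y : W, same_rank x y) x0 nx0.
have xl v : wolt v x -> exists w : W, same_rank v w.
  by move=> vx; apply: contrapT => /(xmin v vx).
have all_W : forall y : W, exists v : V, same_rank y v.
  apply: contrapT => /existsNP[y0 ny0].
  have [y [ny ymin]] :=
    @wo_min W (fun y => ~ exists v : V, same_rank y v) y0 ny0.
  have yl w : wolt w y -> exists v : V, same_rank w v.
    by move=> wy; apply: contrapT => /(ymin w wy).
  (* The least unmatched elements [x] and [y] would match each other, since all elements below them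
     are matched. *)
  apply: (nx); exists y; constructor=> [v vx|w wy].
    have [w vw] := xl _ vx; exists w => //; apply: contrapT => /negP/negPn yw.
    have [v' v'y] := same_rank_below vw yw.
    by apply: ny; exists v'; apply: same_rank_sym.
  have [v wv] := yl _ wy; exists v; last exact: same_rank_sym.
  apply: contrapT => /negP/negPn xv.
  have [w' w'x] := same_rank_below wv xv.
  by apply: nx; exists w'; apply: same_rank_sym.
have [f fi fr] := same_rank_total all_W.
exists x, f; split=> // v; split=> [[w <-]|/xl[w vw]].
  apply: contrapT => /negP/negPn xw.
  have [w' w'x] := same_rank_below (fr w) xw.
  by apply: nx; exists w'; apply: same_rank_sym.
by exists w; apply: same_rank_fun (fr w) (same_rank_sym vw).
Qed.

End WellOrders.

(** * The Ulm series, Ulm length and countable suprema *)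

Section UlmFiltration.
Variable A : zmodType.
Local Open Scope ring_scope.

Lemma divisible_partW (B : set A) : divisible_part B `<=` B.
Proof. by move=> a /(_ 1%N isT)[b Bb <-]; rewrite mulr1n. Qed.

Lemma divisible_partS (B C : set A) :
  B `<=` C -> divisible_part B `<=` divisible_part C.
Proof.
by move=> BC a Ba n n0; have [b Bb <-] := Ba n n0; exists b => //; apply: BC.
Qed.

Lemma ulm_below_lt (W : wotype) (x y : W) :
  wolt y x -> ulm_below x `<=` divisible_part (@ulm_below A W y).
Proof.
elim/wo_ind: x => x IH yx.
have [[z zx]|xs] := pselect (exists z, wo_succ z x).
  rewrite (ulm_below_succ A zx); have [zltx zmax] := zx.
  apply: divisible_partS; case: (wo_trichotomy y z) => [yz|->//|zy].
    by move=> a /(IH _ zltx yz); apply: divisible_partW.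
  by move/negP: zy => /(_ (zmax _ yx)).
(* As [x] is not a successor, some element lies strictly between [y] and [x]. *)
have [z zx yz] : exists2 z, wolt z x & wolt y z.
  apply: contrapT => nz; apply: xs; exists y; split=> // z zx.
  by apply: contrapT => /negP zy; apply: nz; exists z.
rewrite ulm_below_limit; last by split=> // /(_ y); apply/negP.
by move=> a /(_ z zx); apply: IH.
Qed.

Lemma ulm_below_le (W : wotype) (x y : W) :
  wole y x -> ulm_below x `<=` @ulm_below A W y.
Proof.
case: (wo_trichotomy y x) => [yx _|-> _ //|/negP//].
by move=> a /(ulm_below_lt yx); apply: divisible_partW.
Qed.

(** Taking divisible parts is monotone, so a set divisible within itself survives every stage. *)
Lemma divisible_sub_ulm_below (W : wotype) (x : W) (D : set A) :
  D `<=` divisible_part D -> D `<=` ulm_below x.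
Proof.
move=> DD; elim/wo_ind: x => x IH.
have [x0|x0] := pselect (wo_least x); first by rewrite ulm_below_least.
have [[z zx]|xs] := pselect (exists z, wo_succ z x).
  rewrite (ulm_below_succ A zx).
  by apply: (subset_trans DD); apply: divisible_partS; apply: IH; case: zx.
by rewrite ulm_below_limit // => a Da z zx; apply: IH.
Qed.

Lemma ulm_below_woseg (W : wotype) (x : W) : @ulm A (woseg x) = ulm_below x.
Proof.
pose f (y : wosucc (woseg x)) : W := if y is Some z then sval z else x.
rewrite /ulm (@ulm_below_embedding A (wosucc (woseg x)) W f None) //.
split=> [[[y yx]|] [[z zx]|]//=|[[y yx]|] w /= wy].
- exact: wolt_le.
- exact: negPf.
- exact: wo_refl.
- by exists (Some (exist _ w (wole_lt_trans wy yx))).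
- case: (wo_trichotomy w x) => [wx|->|/negP//]; last by exists None.
  by exists (Some (exist _ w wx)).
Qed.

(** The Ulm length is the least stable position in [wosucc W], whose top [None] is stable by
    hypothesis. *)
Lemma ulm_length_exists (W : wotype) :
  @ulm A (wosucc W) = @ulm A W ->
  exists lambda, ulm_length A lambda /\ wotype_le lambda W.
Proof.
move=> Wstable.
pose P (x : wosucc W) := divisible_part (ulm_below x) = @ulm_below A _ x.
have [x [xP xmin]] : exists x, P x /\ forall y, wolt y x -> ~ P y.
  by apply: (@wo_min _ P None); rewrite /P -/(ulm W) -ulm_wosucc.
exists (woseg x); split; last first.
  have ltS (y : woseg x) : exists w : W, sval y = Some w.
    case: y => -[w|] yx; first by exists w.
    by case: (negP yx); case: (x).
  have [f fE] := choice ltS; exists f; split=> [y z|y w wy].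
    by rewrite [RHS]/wole /= /woseg_le !fE.
  have wx : wolt (Some w : wosucc W) x.
    by apply: wole_lt_trans (svalP y); rewrite fE.
  pose z : woseg x := exist _ (Some w) wx.
  by exists z; have [] := fE z.
split; first by rewrite ulm_wosucc ulm_below_woseg.
(* Otherwise [mu] would be isomorphic to the segment below some [y] preceding [x], and [y] would
   already be stable. *)
move=> mu mu_stable; case: (wo_comparable (woseg x) mu) => // -[y [f [fi fim]]].
case: (xmin (sval y) (svalP y)).
suff yE : @ulm A mu = ulm_below (sval y) by rewrite /P -yE -ulm_wosucc.
pose g (z : wosucc mu) : wosucc W := if z is Some w then sval (f w) else sval y.
have flt w : wolt (sval (f w)) (sval y) by apply/(fim (f w)); exists w.
rewrite /ulm (@ulm_below_embedding A _ _ g None) //.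
split=> [[w|] [w'|] //=|[w|] v /= vw].
- by rewrite -[RHS](fi.1 w w').
- exact: wolt_le (flt w).
- exact: negPf (flt w').
- exact: (wo_refl (sval y)).
- have vx := @wole_lt_trans (wosucc W) _ _ _ vw (svalP (f w)).
  have [|w' w'E] := fi.2 w (exist _ v vx : woseg x); first exact: vw.
  by exists (Some w'); rewrite /= w'E.
- case: (wo_trichotomy v (sval y)) => [vy|->|/negP//]; last by exists None.
  have vx := @wole_lt_trans (wosucc W) _ _ _ (wolt_le vy) (svalP y).
  have [w' w'E] := (fim (exist _ v vx : woseg x)).2 vy.
  by exists (Some w'); rewrite /= w'E.
Qed.

End UlmFiltration.

(** Otherwise the countable segments up to the [s n] would cover [aleph1]. *)
Lemma aleph1_sup (s : nat -> aleph1) : exists x, forall n, wolt (s n) x.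
Proof.
apply: contrapT => /forallNP nx; have [unc seg] := aleph1P; apply: unc.
pose F n (b : bool) := if b then [set y | wolt y (s n)] else [set s n].
have : countable (\bigcup_n \bigcup_b F n b).
  apply: bigcup_countable => // n _; apply: bigcup_countable => // -[] _.
    exact: seg.
  exact: countable1.
apply: sub_countable; apply: subset_card_le => x _.
have /existsNP[n nsx] := nx x; exists n => //.
by case: (wo_trichotomy x (s n)) => [|->|//]; [exists true|exists false].
Qed.

Lemma aleph1_inhabited : [set: aleph1] !=set0.
Proof.
apply/set0P/eqP => aleph1_0; case: aleph1P; rewrite aleph1_0.
by case; apply: countable0.
Qed.

Lemma ulm_sub_below (A : zmodType) (W : wotype) (x : W) :
  @ulm A W `<=` ulm_below x.
Proof.
pose f : W -> wosucc W := Some.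
have fi : initial_embedding f by split=> [//|y [w|]] // _; exists w.
by rewrite (ulm_below_embedding A x fi); apply: ulm_below_le.
Qed.

(** * Stabilization of the Ulm series of the kernel *)

Section UlmKernel.
Variable H : nat -> groupType.
Local Open Scope ring_scope.
Local Notation K := (kernel (Ab_prod_map H)).

(** Quantifies [b = c *+ n.+1]: one [k] bounds the commutator length of the defect in all
    coordinates. *)
Definition bounded_step (k n : nat) (b c : K) : Prop :=
  forall i, comm_prod k ((coset_rep b i)^-1 * coset_rep c i ^+ n.+1)%g.

Lemma mulrn_bounded_step n (b c : K) :
  b = c *+ n.+1 -> exists k, bounded_step k n b c.
Proof.
move/(kernel_mulrn_eq n.+1 (esym (Ab_repr _)) (esym (Ab_repr _))).
move=> /derived_comm_prod[k /comm_prod_gprod Ck]; exists k => i.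
by have := Ck i; rewrite -gprodX.
Qed.

Definition bounded_chain (s : nat -> nat) (m : nat) (a : K) (c : nat -> K) :=
  c 0 = a /\ forall n, (n < m)%N -> bounded_step (s n) n (c n) (c n.+1).

(* The witnessing chains may depend on x; only the bounds s are kept. *)
Definition deep (a : K) (s : seq nat) : Prop :=
  forall x : aleph1, exists2 c,
    bounded_chain (nth 0 s) (size s) a c & ulm_below x (c (size s)).

(** If each [k] failed at some [x k], a chain ending beyond all of these could be lengthened, and
    the bound of its new step would contradict the failure for that bound. *)
Lemma deep_rcons (a : K) s : deep a s -> exists k, deep a (rcons s k).
Proof.
move=> s_deep; apply: contrapT => /forallNP nk.
have xex k : exists x : aleph1, ~ exists2 c,
    bounded_chain (nth 0 (rcons s k)) (size (rcons s k)) a c &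
    ulm_below x (c (size (rcons s k))).
  by apply/existsNP; apply: nk.
have [x xP] := choice xex.
(* [y] lies above all [x k]; [z] above [y] leaves room for one more division. *)
have [y xy] := aleph1_sup x; have [z yz] := aleph1_sup (fun=> y).
have [c [c0 cs] cz] := s_deep z.
have [b yb bc] := ulm_below_lt (yz 0) cz (ltn0Sn (size s)).
have [k bk] := mulrn_bounded_step (esym bc).
apply: (xP k); rewrite size_rcons.
exists (fun n => if (n <= size s)%N then c n else b); last first.
  by rewrite ltnn; apply: ulm_below_le yb; apply: wolt_le.
split=> // n; rewrite ltnS nth_rcons => ns; rewrite ns.
move: ns; rewrite leq_eqVlt => /orP[/eqP->|ns]; first by rewrite ltnn eqxx.
by rewrite ns; apply: cs.
Qed.

Lemma deep_factorial_chain (a : K) :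
  deep a [::] -> exists2 d : nat -> K, d 0 = a & factorial_chain d.
Proof.
move=> a_deep.
have fex s : exists k, deep a s -> deep a (rcons s k).
  have [/deep_rcons[k]|] := pselect (deep a s); first by exists k.
  by exists 0.
have [f fP] := choice fex.
(* [S m] is the prefix of length [m] of an infinite branch of bounds. *)
pose S m := iter m (fun s => rcons s (f s)) [::].
have S_deep m : deep a (S m) by elim: m => //= m; apply: fP.
have sizeS m : size (S m) = m by elim: m => //= m IH; rewrite size_rcons IH.
have nthS m n : (n < m)%N -> nth 0 (S m) n = f (S n).
  elim: m => //= m IH; rewrite ltnS leq_eqVlt nth_rcons sizeS.
  by case/orP=> [/eqP->|nm]; rewrite ?ltnn ?eqxx // nm IH.
have [x0 _] := aleph1_inhabited.
have cex i : exists c, bounded_chain (f \o S) i a c.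
  have [c [c0 cS] _] := S_deep i x0; rewrite sizeS in cS.
  by exists c; split=> // n ni; have := cS n ni; rewrite nthS.
have [c cP] := choice cex.
(* Coordinate [i] follows a chain of length [i] and is trivial past its end. *)
pose b n : gprod H := fun i => if (n <= i)%N then coset_rep (c i n) i else 1%g.
have Db n i : derived (b n i).
  rewrite /b; case: ifP => _; first exact: derived_coset_rep.
  by case: (derived_subgroup (H i)).
exists (fun n => kernel_class (Db n)) => [|n].
  apply: val_inj; rewrite -[RHS]Ab_repr /=; congr Ab_proj.
  by apply: functional_extensionality_dep => i; rewrite /b /= (cP i).1.
apply: (iffRL (@kernel_mulrn_eq _ _ _ (b n) (b n.+1) _ _ _)) => //.
have bE i : ((b n)^-1 * b n.+1 ^+ n.+1)%g i = ((b n i)^-1 * b n.+1 i ^+ n.+1)%g.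
  by rewrite -gprodX.
apply/derived_gprodP; split=> [i|].
  by rewrite bE; apply: derivedM; [apply: derivedV | apply: derivedX].
(* For [i > n] the chain of length [i] contains step [n], whose bound [f (S n)] does not depend on
   [i]. *)
exists (f (S n)), n.+1 => i ni; rewrite bE /b ni (ltnW ni).
exact: (cP i).2.
Qed.

(** An element of this stage starts a factorial chain; the span of the chain is divisible, so it
    stays in the next stage. *)
Lemma ulm_aleph1_stable : @ulm K (wosucc aleph1) = ulm aleph1.
Proof.
rewrite ulm_wosucc; apply/seteqP; split=> [|a a_ulm].
  exact: divisible_partW.
have [x|d d0 dS] := @deep_factorial_chain a.
  by exists (fun=> a) => //; apply: ulm_sub_below.
have D_ulm := @divisible_sub_ulm_below K (wosucc aleph1) None _
  (chain_span_divisible dS).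
apply: (divisible_partS D_ulm); apply: (chain_span_divisible dS).
by apply/asboolP; exists 0, 1; rewrite d0.
Qed.

End UlmKernel.

Theorem theorem0p0p5 (H : nat -> groupType) :
  (forall b : zprod (fun i => Ab (H i)),
     exists a : Ab (gprod H), Ab_prod_map H a = b) /\
  cotorsion (kernel (Ab_prod_map H)) /\
  exists lambda : wotype,
    ulm_length (kernel (Ab_prod_map H)) lambda /\ wotype_le lambda aleph1.
Proof.
split; first exact: Ab_prod_map_surj.
split.
  by apply: factorial_system_cotorsion; apply: kernel_factorial_system.
by apply: ulm_length_exists; apply: ulm_aleph1_stable.
Qed.
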